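(* Let $n\ge 1$, let $\Omega$ be a finite subset of $\mathbb{Z}^n$, let $V:\Omega\to[0,\infty)$ be a nonnegative potential and $\rho:\Omega\to(0,\infty)$ a positive density, and let $0<\lambda_1\le\lambda_2\le\cdots\le\lambda_{\sharp\Omega}$ be the eigenvalues, counted with multiplicity, of the weighted Dirichlet Schrödinger problem $$-\Delta u+Vu=\lambda\rho u \ \text{ in } \Omega,\qquad u=0\ \text{ on } \partial\Omega .$$ Put $\rho_{\min}=\min_{\Omega}\rho$ and $\rho_{\max}=\max_{\Omega}\rho$. Then for every integer $k$ with $1\le k\le \sharp\Omega-1$, $$\sum_{i=1}^{k}\frac{\lambda_i}{\lambda_{k+1}-\lambda_i}\ge \frac{nk}{4}\left(\frac{\rho_{\min}}{\rho_{\max}}-\frac{\rho_{\min}}{k}\sum_{i=1}^{k}\lambda_i\right),$$ where the left-hand side is understood as $+\infty$ if $\lambda_{k+1}=\lambda_i$ for some $i\le k$.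
   Context: $\mathbb{Z}^n$ is the integer lattice graph: $x\sim y$ if and only if $\sum_{i=1}^n|x_i-y_i|=1$; every vertex has degree $d_x=2n$. The discrete (normalized) Laplacian is $\Delta f(x)=\frac{1}{d_x}\sum_{y\sim x}(f(y)-f(x))$. The vertex boundary is $\partial\Omega=\{y\in\mathbb{Z}^n\setminus\Omega: y\sim x\text{ for some }x\in\Omega\}$. Functions on $\Omega$ are extended by zero to $\mathbb{Z}^n$, so the eigenvalue problem asks for nonzero $u:\Omega\to\mathbb{R}$, extended by zero, with $-\Delta u(x)+V(x)u(x)=\lambda\rho(x)u(x)$ for all $x\in\Omega$. The operator $(-\Delta+V)/\rho$ with this Dirichlet condition is self-adjoint on $\ell^2(\Omega,\rho)$, with inner product $\langle f,g\rangle=\sum_{x\in\Omega}f(x)g(x)\rho(x)d_x$, and has $\sharp\Omega$ real positive eigenvalues counted with multiplicity. $\sharp\Omega$ denotes the cardinality of $\Omega$. *)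

(* Defs.v *)
From HB Require Import structures.
From mathcomp Require Import all_boot all_order all_algebra.
From mathcomp Require Import finmap.
From mathcomp Require Import all_classical all_reals.

Set Implicit Arguments.
Unset Strict Implicit.
Unset Printing Implicit Defensive.

Import Order.TTheory GRing.Theory Num.Theory.

Local Open Scope classical_set_scope.
Local Open Scope ring_scope.

Definition adj n (x y : 'rV[int]_n) : bool :=
  \sum_(i < n) `|x 0 i - y 0 i| == 1 :> int.

Definition neighbours n (x : 'rV[int]_n) : set 'rV[int]_n :=
  [set y | adj x y].

Definition lattice_step n (x : 'rV[int]_n) (p : 'I_n * bool) : 'rV[int]_n :=
  x + (-1) ^+ p.2 *: delta_mx 0 p.1.

Lemma lattice_stepE n (x : 'rV[int]_n) p i :
  lattice_step x p 0 i = x 0 i + (-1) ^+ p.2 * (i == p.1)%:R.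
Proof. by rewrite !mxE eqxx. Qed.

Lemma lattice_step_inj n (x : 'rV[int]_n) : injective (lattice_step x).
Proof.
move=> [i b] [j c] /addrI /matrixP/(_ 0 i); rewrite !mxE /= !eqxx /=.
case: (eqVneq i j) => [<-|_]; first by case: b; case: c.
by case: b; rewrite mulr0.
Qed.

Lemma adjP n (x y : 'rV[int]_n) :
  reflect (exists p, y = lattice_step x p) (adj x y).
Proof.
apply: (iffP eqP) => [h|[p ->]]; last first.
  rewrite (bigD1 p.1) //= big1 => [|i ip].
    by rewrite lattice_stepE eqxx; case: p.2; rewrite mulr1 opprD addrA subrr.
  by rewrite lattice_stepE (negbTE ip) mulr0 addr0 subrr normr0.
have [i xyi] : exists i, x 0 i != y 0 i.
  apply/existsP; apply: contra_eqT h => /existsPn xy.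
  by rewrite big1 // => i _; move: (xy i) => /negPn/eqP ->; rewrite subrr normr0.
have ge0 : 0 <= \sum_(j < n | j != i) `|x 0 j - y 0 j| by exact: sumr_ge0.
have xyi1 : 1 <= `|x 0 i - y 0 i| by rewrite -gtz0_ge1 normr_gt0 subr_eq0.
move: h; rewrite (bigD1 i) //= => h.
have s0 : \sum_(j < n | j != i) `|x 0 j - y 0 j| = 0.
  by apply/eqP; rewrite eq_le ge0 andbT -(lerD2l `|x 0 i - y 0 i|) h addr0.
have d1 : `|x 0 i - y 0 i| = 1 by move: h; rewrite s0 addr0.
have yj j : j != i -> y 0 j = x 0 j.
  move=> ji; apply/eqP; rewrite eq_sym -subr_eq0 -normr_eq0; apply/eqP.
  by apply: (psumr_eq0P _ s0) => // k _; exact: normr_ge0.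
exists (i, 0 <= x 0 i - y 0 i); apply/rowP => j; rewrite lattice_stepE /=.
have [->|/yj ->] := eqVneq j i; last by rewrite mulr0 addr0.
move: d1; rewrite mulr1; case: (ger0P (x 0 i - y 0 i)) => _ d1.
  by rewrite expr1 -d1 opprB addrC subrK.
by rewrite expr0 -d1 opprB addrC subrK.
Qed.

Lemma neighboursE n (x : 'rV[int]_n) :
  neighbours x = lattice_step x @` [set: 'I_n * bool].
Proof.
apply/seteqP; split=> [y /adjP[p ->]|_ [p _ <-]]; first by exists p.
by apply/adjP; exists p.
Qed.

Lemma finite_neighbours n (x : 'rV[int]_n) : finite_set (neighbours x).
Proof. by rewrite neighboursE; exact: finite_image. Qed.

Definition laplacian (R : realType) n (f : 'rV[int]_n -> R) (x : 'rV[int]_n)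
    : R :=
  (2 * n)%:R^-1 * \sum_(y \in neighbours x) (f y - f x).

(* In particular every vertex has exactly 2 * n neighbours. *)
Lemma laplacianE (R : realType) n (f : 'rV[int]_n -> R) x :
  laplacian f x = (2 * n)%:R^-1 * \sum_p (f (lattice_step x p) - f x).
Proof.
rewrite /laplacian neighboursE; congr (_ * _).
rewrite fsbig_image; last by move=> p q _ _; exact: lattice_step_inj.
rewrite (fsbigE (index_enum _)) ?index_enum_uniq //=.
  by apply: eq_bigl => p; rewrite in_setT.
by move=> p _; rewrite mem_index_enum.
Qed.

Definition extend0 (R : realType) n (Omega : {fset 'rV[int]_n})
    (u : Omega -> R) (x : 'rV[int]_n) : R :=
  oapp u 0 (insub x).

(* The operator (- Delta + V) / rho; functions on Omega take values in R^o, the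
   vector space R over itself, so that they form a vectType. *)
Definition schrodinger (R : realType) n (Omega : {fset 'rV[int]_n})
    (V rho : Omega -> R) (u : {ffun Omega -> R^o}) : {ffun Omega -> R^o} :=
  [ffun x => (- laplacian (extend0 u) (val x) + V x * u x) / rho x].

Lemma schrodinger_is_linear (R : realType) n (Omega : {fset 'rV[int]_n})
    (V rho : Omega -> R) : linear (schrodinger V rho).
Proof.
move=> a u v; apply/ffunP => x; rewrite !ffunE.
have extD y : extend0 (a *: u + v) y = a * extend0 u y + extend0 v y.
  rewrite /extend0; case: insub => [z|] /=; first by rewrite !ffunE.
  by rewrite mulr0 addr0.
have lapD y : laplacian (extend0 (a *: u + v)) y =
    a * laplacian (extend0 u) y + laplacian (extend0 v) y.
  rewrite !laplacianE [a * _]mulrCA -mulrDr; congr (_ * _).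
  rewrite mulr_sumr -big_split /=.
  by apply: eq_bigr => p _; rewrite !extD mulrBr opprD addrACA.
rewrite lapD.
have distr (c d p q r t : R) : (- (a * p + q) + c * (a * r + t)) / d =
    a * ((- p + c * r) / d) + (- q + c * t) / d.
  rewrite mulrA -mulrDl; congr (_ / _).
  by rewrite mulrDr opprD mulrDr mulrN [c * (a * r)]mulrCA addrACA.
exact: distr.
Qed.

HB.instance Definition _ (R : realType) n (Omega : {fset 'rV[int]_n})
    (V rho : Omega -> R) :=
  GRing.isLinear.Build R {ffun Omega -> R^o} {ffun Omega -> R^o} _
    (schrodinger V rho) (schrodinger_is_linear V rho).

Definition dirichlet_eigenspace (R : realType) n (Omega : {fset 'rV[int]_n})
    (V rho : Omega -> R) (mu : R) : {vspace {ffun Omega -> R^o}} :=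
  passmx.leigenspace (linfun (schrodinger V rho)) mu.

Lemma mem_dirichlet_eigenspace (R : realType) n (Omega : {fset 'rV[int]_n})
    (V rho : Omega -> R) (mu : R) (u : {ffun Omega -> R^o}) :
  (forall x, 0 < rho x) ->
  u \in dirichlet_eigenspace V rho mu <->
  (forall x : Omega,
     - laplacian (extend0 u) (val x) + V x * u x = mu * rho x * u x).
Proof.
move=> rho0; rewrite /dirichlet_eigenspace /passmx.leigenspace memv_ker.
rewrite add_lfunE opp_lfunE scale_lfunE id_lfunE lfunE /= subr_eq0.
have rn x : rho x != 0 by rewrite gt_eqF.
split=> [/eqP/ffunP h x|h].
  have := h x; rewrite !ffunE => /(canRL (divfK (rn x))) ->.
  by rewrite mulrAC.
apply/eqP/ffunP => x; rewrite !ffunE h mulrAC mulfK //.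
Qed.

(* s lists all the eigenvalues in nondecreasing order, each repeated according
   to the dimension of its eigenspace: lambda_i is s`_(i - 1). *)
Definition eigenvalue_seq (R : realType) n (Omega : {fset 'rV[int]_n})
    (V rho : Omega -> R) (s : seq R) : Prop :=
  [/\ size s = #|` Omega|,
      sorted <=%R s &
      forall mu : R, count_mem mu s = \dim (dirichlet_eigenspace V rho mu)].

Definition is_min (R : realType) (T : Type) (f : T -> R) (m : R) : Prop :=
  (exists x, f x = m) /\ (forall x, m <= f x).

Definition is_max (R : realType) (T : Type) (f : T -> R) (m : R) : Prop :=
  (exists x, f x = m) /\ (forall x, f x <= m).

(* The sum of lambda_i / (lambda_(k+1) - lambda_i) for 1 <= i <= k. *)
Definition gap_sum (R : realType) (s : seq R) (k : nat) : \bar R :=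
  if [exists i : 'I_k, s`_k == s`_i] then +oo%E
  else (\sum_(i < k) s`_i / (s`_k - s`_i))%:E.

(* Main.v *)
From HB Require Import structures.
Require Import Defs.
From mathcomp Require Import all_boot all_order all_algebra.
From mathcomp Require Import finmap.
From mathcomp Require Import all_classical all_reals.
From mathcomp Require Import ring lra.

(** The bound comes from the commutators of the operator L = (- Delta + V) / rho
with the multiplications by the coordinates x_a, in the way of Hile and
Protter.

Let e_0, e_1, ... be an eigenbasis that is orthonormal for the inner product
with weight rho, with eigenvalues l_j, let G be a symmetric operator and put
r_i = (L - l_i) (G e_i).  With a_ij = <G e_i, e_j>, the coordinates of r_i are
(l_j - l_i) a_ij, hence <r_i, G e_i> is the sum over j of (l_j - l_i) a_ij^2.
When i also is summed, over i < k, the terms with j < k cancel because a_ij is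
symmetric; in the others l_j - l_i >= l_k - l_i, and therefore
(lemma commutator_gap_le)

  sum_(i < k) <r_i, G e_i>  <=  sum_(i < k) |r_i|^2 / (l_k - l_i).

Take for G the multiplication by x_a, and write u for e_i, extended by zero.
Then r_i(x) is - (u(x + a) - u(x - a)) / (2 n rho(x)) by the discrete Leibniz
rule.  Let S be the sum of u^2 and K that of u (- Delta u); K <= l_i because
V >= 0, and S >= 1 / rho_max because u has norm 1.  Summation by parts
gives, once the directions a are added up:
- <r_i, G e_i> totals (S - K) / 2, which is at least (1 / rho_max - l_i) / 2
  (commutator_pairing_ge);
- |r_i|^2 totals at most 2 K / (n rho_min) <= 2 l_i / (n rho_min)
  (commutator_norm_le).
The theorem is the inequality above with these two bounds, multiplied by
n rho_min / 2.

The eigenbasis requires no spectral theorem: the list of eigenvalues has as many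
entries as the space has dimensions and repeats each value according to
the dimension of its eigenspace, and mutually orthogonal eigenvectors can be
chosen one at a time along it (orthonormal_eigenvectors). *)

Set Implicit Arguments.
Unset Strict Implicit.
Unset Printing Implicit Defensive.

Import Order.TTheory GRing.Theory Num.Theory.

Local Open Scope ring_scope.

(** * Symmetric operators on a weighted finite l2 space *)

Section WeightedDot.
Variables (R : rcfType) (T : finType) (w : T -> R).
Implicit Types u v z : {ffun T -> R^o}.

Definition wdot u v : R := \sum_x w x * ((u x : R) * (v x : R)).

Lemma wdotC u v : wdot u v = wdot v u.
Proof. by apply: eq_bigr => x _; rewrite (mulrC (u x : R)). Qed.

Lemma wdot_linearl v a u z : wdot (a *: u + z) v = a * wdot u v + wdot z v.
Proof.
rewrite /wdot mulr_sumr -big_split; apply: eq_bigr => x _ /=.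
have -> : (a *: u + z) x = a * (u x : R) + (z x : R) :> R by rewrite !ffunE.
by ring.
Qed.

Lemma wdot0l v : wdot 0 v = 0.
Proof. by rewrite /wdot big1 // => x _; rewrite ffunE mul0r mulr0. Qed.

Lemma wdotDl u z v : wdot (u + z) v = wdot u v + wdot z v.
Proof. by rewrite -[u]scale1r wdot_linearl mul1r scale1r. Qed.

Lemma wdotZl a u v : wdot (a *: u) v = a * wdot u v.
Proof. by rewrite -[a *: u]addr0 wdot_linearl wdot0l addr0. Qed.

Lemma wdotZr a u v : wdot u (a *: v) = a * wdot u v.
Proof. by rewrite wdotC wdotZl wdotC. Qed.

Lemma wdotBl u z v : wdot (u - z) v = wdot u v - wdot z v.
Proof. by rewrite wdotDl -scaleN1r wdotZl mulN1r. Qed.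

Lemma wdot_suml (I : Type) (r : seq I) (P : pred I)
    (F : I -> {ffun T -> R^o}) v :
  wdot (\sum_(i <- r | P i) F i) v = \sum_(i <- r | P i) wdot (F i) v.
Proof.
by elim/big_rec2: _ => [|i y1 y2 _ <-]; rewrite ?wdot0l ?wdotDl.
Qed.

Hypothesis w_gt0 : forall x, 0 < w x.

Lemma wdot_gt0 u : u != 0 -> 0 < wdot u u.
Proof.
have ge0 x : 0 <= w x * (u x * u x).
  by rewrite mulr_ge0 ?(ltW (w_gt0 x)) // -expr2 sqr_ge0.
move=> u0; rewrite lt_def sumr_ge0 // andbT; apply: contra u0 => /eqP s0.
apply/eqP/ffunP => x; rewrite ffunE.
have /eqP : w x * ((u x : R) * (u x : R)) = 0 by apply: (psumr_eq0P _ s0).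
by rewrite mulf_eq0 gt_eqF //= -expr2 sqrf_eq0 => /eqP.
Qed.

Definition orthonormal (m : nat) (e : nat -> {ffun T -> R^o}) :=
  forall i j, (i < m)%N -> (j < m)%N -> wdot (e i) (e j) = (i == j)%:R.

Lemma orthonormal_sum m e (P : pred nat) (c : nat -> R) j :
  orthonormal m e -> (j < m)%N ->
  wdot (\sum_(0 <= i < m | P i) c i *: e i) (e j) = if P j then c j else 0.
Proof.
move=> oe jm; rewrite wdot_suml big_mkord.
rewrite (eq_bigr (fun i : 'I_m => if i == Ordinal jm then c i else 0)).
  by rewrite -big_mkcondr big_mkcondl /= big_pred1_eq.
move=> i _; rewrite wdotZl oe //.
by rewrite -(inj_eq val_inj) /=; case: eqP; rewrite ?mulr1 ?mulr0.
Qed.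

(** As many orthonormal vectors as there are points form a basis, since
orthonormal vectors are linearly independent. *)
Lemma parseval (e : nat -> {ffun T -> R^o}) u v :
  orthonormal #|T| e ->
  wdot u v = \sum_(0 <= j < #|T|) wdot u (e j) * wdot v (e j).
Proof.
move=> oe; pose X := [tuple e i | i < #|T|].
have XE (i : 'I_#|T|) : X`_i = e i by rewrite -tnth_nth tnth_mktuple.
have sumX (c : nat -> R) :
    \sum_(i < #|T|) c i *: X`_i = \sum_(0 <= i < #|T|) c i *: e i.
  by rewrite big_mkord; apply: eq_bigr => i _; rewrite XE.
have freeX : free X.
  apply/freeP => k.
  (* [k'] is [k] as a function on all of nat, which orthonormal_sum expects. *)
  pose k' i := if insub i is Some j then k j else 0.
  have k'E i : k i = k' i by rewrite /k' valK.
  under eq_bigr do rewrite k'E; rewrite sumX => s0 j; rewrite k'E.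
  have := orthonormal_sum predT k' oe (ltn_ord j).
  by rewrite s0 wdot0l.
have basisX : basis_of fullv X.
  rewrite basisEfree freeX subvf size_tuple dimvf /=.
  by rewrite /dim /= muln1.
have [c ->] : exists c : nat -> R, u = \sum_(0 <= i < #|T|) c i *: e i.
  exists (fun i => if insub i is Some j then coord X j u else 0).
  rewrite -sumX {1}(coord_basis basisX (memvf u)).
  by apply: eq_bigr => i _; rewrite valK.
rewrite wdot_suml [LHS]big_nat [RHS]big_nat; apply: eq_bigr => i /andP[_ im].
by rewrite wdotZl (orthonormal_sum predT) // (wdotC v).
Qed.

(** The vector L (G e_i) - lam_i G e_i is the commutator of L and G applied to
e_i, so its coordinates (lam_j - lam_i) <G e_i, e_j> are antisymmetric in i and j.
That removes from the sum on the left all indices j below k, and the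
remaining gaps lam_j - lam_i are at least lam_k - lam_i. *)
Lemma commutator_gap_le (L G : {ffun T -> R^o} -> {ffun T -> R^o})
    (e : nat -> {ffun T -> R^o}) (lam : nat -> R) (k : nat) :
  (forall u v, wdot (L u) v = wdot u (L v)) ->
  (forall u v, wdot (G u) v = wdot u (G v)) ->
  orthonormal #|T| e ->
  (forall i, (i < #|T|)%N -> L (e i) = lam i *: e i) ->
  (k < #|T|)%N ->
  (forall i, (i < k)%N -> lam i < lam k) ->
  (forall j, (k <= j < #|T|)%N -> lam k <= lam j) ->
  \sum_(0 <= i < k) wdot (L (G (e i)) - lam i *: G (e i)) (G (e i)) <=
  \sum_(0 <= i < k) wdot (L (G (e i)) - lam i *: G (e i))
                         (L (G (e i)) - lam i *: G (e i)) / (lam k - lam i).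
Proof.
move=> symL symG oe eigE kT ltk gek.
pose a i j := wdot (G (e i)) (e j).
have aC i j : a i j = a j i by rewrite /a symG wdotC.
have rE i j : (i < k)%N -> (j < #|T|)%N ->
    wdot (L (G (e i)) - lam i *: G (e i)) (e j) = (lam j - lam i) * a i j.
  by move=> ik jT; rewrite wdotBl symL eigE // wdotZr wdotZl mulrBl.
pose F i j := (lam j - lam i) * a i j ^+ 2.
have splitF : \sum_(0 <= i < k) \sum_(0 <= j < #|T|) F i j =
    \sum_(0 <= i < k) \sum_(k <= j < #|T|) F i j.
  under eq_bigr do rewrite (big_cat_nat (leq0n k) (ltnW kT)) /=.
  rewrite big_split /= -[RHS]add0r; congr (_ + _).
  have : \sum_(0 <= i < k) \sum_(0 <= j < k) F i j =
      - \sum_(0 <= i < k) \sum_(0 <= j < k) F i j.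
    (* Exchanging i and j changes the sign of F. *)
    rewrite [LHS]exchange_big /= -sumrN; apply: eq_bigr => i _.
    by rewrite -sumrN; apply: eq_bigr => j _; rewrite /F (aC i j); ring.
  by lra.
rewrite (_ : \sum_(0 <= i < k) _ = \sum_(0 <= i < k) \sum_(0 <= j < #|T|) F i j).
  rewrite splitF [leLHS]big_nat [leRHS]big_nat.
  apply: ler_sum => i /andP[_ ik].
  rewrite (parseval _ _ oe) (big_cat_nat (leq0n k) (ltnW kT)) /= mulrDl.
  have gap0 : 0 < lam k - lam i by rewrite subr_gt0 ltk.
  rewrite -[leLHS]add0r lerD //.
    rewrite mulr_ge0 ?invr_ge0 ?(ltW gap0) //.
    by apply: sumr_ge0 => j _; rewrite -expr2 sqr_ge0.
  rewrite mulr_suml [leLHS]big_nat [leRHS]big_nat.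
  apply: ler_sum => j /andP[kj jT].
  have kjle : lam k <= lam j by rewrite gek ?kj.
  rewrite rE // ler_pdivlMr // /F.
  rewrite (_ : _ * a i j * _ = (lam j - lam i) * a i j ^+ 2 * (lam j - lam i)).
    by rewrite ler_wpM2l ?lerD2r // mulr_ge0 ?sqr_ge0 // subr_ge0; lra.
  by ring.
rewrite [LHS]big_nat [RHS]big_nat; apply: eq_bigr => i /andP[_ ik].
rewrite (parseval _ _ oe) [LHS]big_nat [RHS]big_nat.
by apply: eq_bigr => j /andP[_ jT]; rewrite rE // /F /a; ring.
Qed.

(** Induction on the list.  A new vector for the value mu has to be orthogonal to
the vectors already chosen; by symmetry of L this is automatic for those with
another eigenvalue, and those with eigenvalue mu are fewer than the dimension
of the eigenspace, so that projecting the eigenspace onto their span has a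
nonzero kernel. *)
Lemma orthonormal_eigenvectors (L : {linear {ffun T -> R^o} -> {ffun T -> R^o}})
    (s : seq R) :
  (forall u v, wdot (L u) v = wdot u (L v)) ->
  (forall mu, (count_mem mu s <= \dim (passmx.leigenspace (linfun L) mu))%N) ->
  exists e : nat -> {ffun T -> R^o},
    orthonormal (size s) e /\
    forall i, (i < size s)%N -> L (e i) = s`_i *: e i.
Proof.
move=> symL; elim: s => [|mu s IH] dimE; first by exists (fun=> 0); split.
case: IH => [nu|e [oe eigE]].
  by apply: leq_trans (dimE nu); rewrite /= leq_addl.
have memE u : (u \in passmx.leigenspace (linfun L) mu) = (L u == mu *: u).
  rewrite /passmx.leigenspace memv_ker add_lfunE opp_lfunE scale_lfunE.
  by rewrite id_lfunE lfunE /= subr_eq0.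
pose f u : {ffun T -> R^o} :=
  \sum_(0 <= i < size s | s`_i == mu) wdot u (e i) *: e i.
have f_lin : linear f.
  move=> a u v; rewrite /f scaler_sumr -big_split /=; apply: eq_bigr => i _.
  by rewrite wdot_linearl scalerDl scalerA.
pose fL := GRing.isLinear.Build _ _ _ _ f f_lin.
pose fl : {linear {ffun T -> R^o} -> {ffun T -> R^o}} := HB.pack f fL.
set E := passmx.leigenspace _ mu in memE.
pose X := [seq e i | i <- iota 0 (size s) & s`_i == mu].
have imX : (linfun fl @: E <= <<X>>)%VS.
  apply/subvP => _ /memv_imgP[u _ ->]; rewrite lfunE /=.
  rewrite /f -big_filter big_seq; apply: rpred_sum => i.
  rewrite /index_iota subn0 => iP; apply/rpredZ/memv_span.
  exact: map_f.
have sizeX : size X = count_mem mu s.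
  rewrite size_map size_filter -[s in RHS](mkseq_nth 0) /mkseq count_map.
  by apply: eq_count.
have : (0 < \dim (E :&: lker (linfun fl)))%N.
  have := limg_ker_dim (linfun fl) E.
  have := leq_trans (dimvS imX) (dim_span X).
  have := dimE mu; rewrite /= eqxx sizeX => h1 h2 h3.
  rewrite -(ltn_add2r (\dim (linfun fl @: E))) h3 add0n.
  exact: leq_trans h1.
rewrite lt0n dimv_eq0 -vpick0; set u := vpick _ => u0.
have := memv_pick (E :&: lker (linfun fl)); rewrite -/u memv_cap memv_ker lfunE.
case/andP; rewrite memE => /eqP uE /eqP /= fu0.
have ue i : (i < size s)%N -> wdot u (e i) = 0.
  move=> im; have [si|si] := eqVneq s`_i mu.
    have := orthonormal_sum (fun i => s`_i == mu) (fun i => wdot u (e i)) oe im.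
    by rewrite -/(f u) si eqxx [f u]fu0 wdot0l.
  have /eqP : (mu - s`_i) * wdot u (e i) = 0.
    by rewrite mulrBl -wdotZl -uE -wdotZr -eigE // symL subrr.
  by rewrite mulf_eq0 subr_eq0 eq_sym (negbTE si) => /eqP.
pose c := (Num.sqrt (wdot u u))^-1.
exists (fun i => if i is i'.+1 then e i' else c *: u); split.
  move=> [|i] [|j] //= im jm.
  - rewrite wdotZl wdotZr mulrA -expr2 /c exprVn sqr_sqrtr ?mulVf //.
      by rewrite gt_eqF ?wdot_gt0.
    by rewrite ltW ?wdot_gt0.
  - by rewrite wdotZl ue ?mulr0.
  - by rewrite wdotC wdotZl ue ?mulr0.
  - by rewrite oe.
by move=> [|i] //= im; rewrite ?eigE // linearZ /= uE !scalerA mulrC.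
Qed.
End WeightedDot.

(** * The Dirichlet problem on a finite set of lattice points *)

Section Lattice.
Variables (R : realType) (n : nat) (Omega : {fset 'rV[int]_n}).
Local Notation dir a := (delta_mx 0 a : 'rV[int]_n).

Lemma extend0_val (u : Omega -> R) (x : Omega) : extend0 u (val x) = u x.
Proof. by rewrite /extend0 valK. Qed.

Lemma extend0_sum (u : Omega -> R) y :
  extend0 u y = \sum_(z : Omega | val z == y) u z.
Proof.
rewrite /extend0; case: insubP => [z _ <-|yO] /=.
  by rewrite (big_pred1 z) // => t /=; rewrite (inj_eq val_inj).
rewrite big_pred0 // => z; apply/negP => /eqP zy.
by move/negP: yO; apply; rewrite -zy (valP z).
Qed.

(** Summation by parts, inside Omega: both sides add u y * v x over the pairs of
points of Omega with y = x + d. *)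
Lemma sum_shift (u v : Omega -> R) d :
  \sum_x extend0 u (val x + d) * v x = \sum_x u x * extend0 v (val x - d).
Proof.
under eq_bigr do rewrite extend0_sum mulr_suml.
under [RHS]eq_bigr do rewrite extend0_sum mulr_sumr.
rewrite (exchange_big_dep xpredT) //=; apply: eq_bigr => z _.
by apply: eq_bigl => x; rewrite [RHS]eq_sym subr_eq.
Qed.

Lemma sum_shift_le (u : Omega -> R) d :
  (forall x, 0 <= u x) -> \sum_(x : Omega) extend0 u (val x + d) <= \sum_x u x.
Proof.
move=> u0; have := sum_shift u (fun=> 1) d.
under eq_bigr do rewrite mulr1.
move=> ->; apply: ler_sum => x _; rewrite -[leRHS]mulr1.
by rewrite ler_wpM2l // /extend0; case: insub => //= _.
Qed.

Lemma laplacian_dirE (f : 'rV[int]_n -> R) x :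
  laplacian f x =
  (2 * n)%:R^-1 * \sum_a (f (x + dir a) + f (x - dir a) - 2 * f x).
Proof.
rewrite laplacianE; congr (_ * _).
rewrite -(pair_bigA _ (fun a b => f (lattice_step x (a, b)) - f x)) /=.
apply: eq_bigr => a _; rewrite big_bool /lattice_step /= expr1 expr0.
by rewrite scaleN1r scale1r; ring.
Qed.

Lemma laplacian_symmetric (u v : Omega -> R) :
  \sum_x laplacian (extend0 u) (val x) * v x =
  \sum_x u x * laplacian (extend0 v) (val x).
Proof.
have E (f g : Omega -> R) : \sum_x f x * laplacian (extend0 g) (val x) =
    (2 * n)%:R^-1 * \sum_a (\sum_x f x * extend0 g (val x + dir a) +
      \sum_x f x * extend0 g (val x - dir a) - 2 * \sum_x f x * g x).
  under eq_bigr do rewrite laplacian_dirE mulrCA mulr_sumr.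
  rewrite -mulr_sumr exchange_big /=; congr (_ * _).
  apply: eq_bigr => a _; rewrite mulr_sumr -big_split /= -sumrB.
  by apply: eq_bigr => x _; rewrite extend0_val; ring.
under eq_bigr do rewrite mulrC; rewrite !E; congr (_ * _).
apply: eq_bigr => a _; rewrite -!sum_shift.
have -> : \sum_x v x * extend0 u (val x + dir a) =
    \sum_x extend0 u (val x + dir a) * v x by apply: eq_bigr => x _; ring.
have -> : \sum_x u x * extend0 v (val x + dir a) =
    \sum_x extend0 v (val x + dir a) * u x by apply: eq_bigr => x _; ring.
have -> : \sum_x v x * u x = \sum_x u x * v x.
  by apply: eq_bigr => x _; ring.
by ring.
Qed.

Definition mass (u : Omega -> R) : R := \sum_x u x ^+ 2.

(** The part in direction a of the adjacency form of Omega; mass u - bond a u is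
half the sum of the squared differences of u along all edges in this direction,
those that leave Omega included. *)
Definition bond (a : 'I_n) (u : Omega -> R) : R :=
  \sum_x u x * extend0 u (val x + dir a).

Lemma bond_opp a u : \sum_x u x * extend0 u (val x - dir a) = bond a u.
Proof. by rewrite -sum_shift; apply: eq_bigr => x _; rewrite mulrC. Qed.

Lemma dirichlet_energyE (u : Omega -> R) :
  \sum_x u x * (- laplacian (extend0 u) (val x)) =
  n%:R^-1 * \sum_a (mass u - bond a u).
Proof.
under eq_bigr do rewrite laplacian_dirE mulrN mulrCA mulr_sumr.
rewrite sumrN -mulr_sumr exchange_big /=.
rewrite (eq_bigr (fun a => - 2 * (mass u - bond a u))) => [|a _].
  rewrite -mulr_sumr natrM invfM.
  by rewrite mulNr mulrN opprK mulrACA mulVf ?mul1r // pnatr_eq0.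
rewrite mulrBr -{1}bond_opp.
rewrite (_ : -2 * mass u - _ = bond a u + bond a u - 2 * mass u); last first.
  by rewrite bond_opp; ring.
rewrite -{1}bond_opp /bond /mass mulr_sumr -big_split /= -sumrB.
by apply: eq_bigr => x _; rewrite extend0_val; ring.
Qed.

Definition coord_mul (a : 'I_n) (u : {ffun Omega -> R^o}) :
    {ffun Omega -> R^o} :=
  [ffun x : Omega => ((val x) 0 a)%:~R * (u x : R)].

Lemma extend0_coord_mul a u y :
  extend0 (coord_mul a u) y = (y 0 a)%:~R * extend0 u y.
Proof.
rewrite /extend0; case: insubP => [z _ <-|_] /=; last by rewrite mulr0.
by rewrite ffunE.
Qed.

(** Discrete Leibniz rule: the Laplacian of the coordinate itself vanishes, and
only the cross term remains, a centred difference where the continuous case has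
twice the partial derivative. *)
Lemma laplacian_coord_mul a (u : {ffun Omega -> R^o}) (x : 'rV[int]_n) :
  laplacian (extend0 (coord_mul a u)) x =
  (x 0 a)%:~R * laplacian (extend0 u) x +
  (2 * n)%:R^-1 * (extend0 u (x + dir a) - extend0 u (x - dir a)).
Proof.
rewrite !laplacian_dirE mulrCA -mulrDr; congr (_ * _).
rewrite mulr_sumr (bigD1 a) //= [in RHS](bigD1 a) //=.
rewrite [in RHS]addrAC; congr (_ + _).
  rewrite !extend0_coord_mul !mxE !eqxx /= rmorphD rmorphB /=.
  by ring.
apply: eq_bigr => b ba; rewrite !extend0_coord_mul !mxE eqxx eq_sym (negbTE ba).
by rewrite /= ?oppr0 !addr0; ring.
Qed.

Variables (V rho : Omega -> R).
Hypothesis rho_gt0 : forall x, 0 < rho x.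

Lemma wdot_schrodinger (u v : {ffun Omega -> R^o}) :
  wdot rho (schrodinger V rho u) v =
  \sum_x (- laplacian (extend0 u) (val x) + V x * u x) * v x.
Proof.
apply: eq_bigr => x _; rewrite ffunE mulrA (mulrC (rho x)) divfK //.
by rewrite gt_eqF.
Qed.

Lemma schrodinger_symmetric (u v : {ffun Omega -> R^o}) :
  wdot rho (schrodinger V rho u) v = wdot rho u (schrodinger V rho v).
Proof.
rewrite [RHS]wdotC !wdot_schrodinger.
under eq_bigr do rewrite mulrDl mulNr; rewrite big_split sumrN /=.
rewrite laplacian_symmetric -sumrN -big_split /=.
by apply: eq_bigr => x _; ring.
Qed.

Lemma coord_mul_symmetric a u v :
  wdot rho (coord_mul a u) v = wdot rho u (coord_mul a v).
Proof. by apply: eq_bigr => x _; rewrite !ffunE; ring. Qed.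

Definition dir_diff (a : 'I_n) (u : {ffun Omega -> R^o}) (x : Omega) : R :=
  extend0 u (val x + dir a) - extend0 u (val x - dir a).

(** The potential commutes with the coordinate, so the commutator does not
depend on V. *)
Lemma commutatorE a u mu x :
  schrodinger V rho u = mu *: u ->
  (schrodinger V rho (coord_mul a u) - mu *: coord_mul a u) x =
  - (2 * n)%:R^-1 * dir_diff a u x / rho x.
Proof.
move=> /ffunP/(_ x); rewrite !ffunE => uE.
rewrite /= laplacian_coord_mul /dir_diff.
have -> : mu *: (((val x) 0 a)%:~R * (u x : R) : R^o) =
   ((val x) 0 a)%:~R * (mu *: u x) :> R by rewrite [LHS]mulrCA.
rewrite -uE.
have ringE (l X D c r z v : R) : (- (X * l + c * D) + v * (X * z)) / r -
    X * ((- l + v * z) / r) = - c * D / r by ring.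
exact: ringE.
Qed.

(** Moving the shift from one factor to the other turns x_a into x_a - 1; the
terms with the coordinate cancel, and the shift by one leaves bond a u. *)
Lemma sum_dir_diff_mul a u :
  \sum_x - dir_diff a u x * coord_mul a u x = bond a u.
Proof.
have E : \sum_x extend0 u (val x + dir a) * coord_mul a u x =
   \sum_x u x * (((val x) 0 a)%:~R * extend0 u (val x - dir a)) - bond a u.
  rewrite sum_shift -bond_opp -sumrB; apply: eq_bigr => x _.
  by rewrite extend0_coord_mul !mxE !eqxx rmorphB /=; ring.
under eq_bigr do rewrite /dir_diff mulNr mulrBl.
rewrite sumrN sumrB E opprB opprB addrCA -[RHS]addr0; congr (_ + _).
rewrite -sumrB big1 // => x _; rewrite ffunE.
have ringE (p X q : R) : p * (X * q) - q * (X * p) = 0 by ring.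
exact: ringE.
Qed.

(** A centred difference is the sum of two differences along edges, and
(p - q)^2 <= 2 (p - z)^2 + 2 (z - q)^2 with z the value at the middle point. *)
Lemma sum_dir_diff_sqr a (u : {ffun Omega -> R^o}) :
  \sum_x dir_diff a u x ^+ 2 <= 8 * (mass u - bond a u).
Proof.
pose sq x := (u x : R) ^+ 2.
have sqE y : extend0 u y ^+ 2 = extend0 sq y.
  by rewrite /extend0; case: insub => //=; rewrite expr0n.
have sq0 x : 0 <= sq x by rewrite sqr_ge0.
have := sum_shift_le (dir a) sq0; have := sum_shift_le (- dir a) sq0.
rewrite -[\sum_x sq x]/(mass u) => hm hp.
pose b x := 2 * extend0 sq (val x + dir a) + 2 * extend0 sq (val x - dir a)
  + 4 * sq x - 4 * (u x * extend0 u (val x + dir a))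
  - 4 * (u x * extend0 u (val x - dir a)).
apply: (@le_trans _ _ (\sum_x b x)).
  (* b x is the right-hand side of that inequality, expanded so that each term can
     be summed over Omega; the difference of the two sides is a square. *)
  apply: ler_sum => x _; rewrite /b -!sqE /dir_diff /sq -subr_ge0.
  set p := extend0 u _; set q := extend0 u _; set z := (u x : R).
  rewrite [leRHS](_ : _ = (p + q - 2 * z) ^+ 2) ?sqr_ge0 //; ring.
rewrite /b !sumrB !big_split /= -!mulr_sumr -[\sum_x sq x]/(mass u).
rewrite bond_opp -/(bond a u); lra.
Qed.

Lemma energy_le_eigenvalue (u : {ffun Omega -> R^o}) mu :
  (forall x, 0 <= V x) -> schrodinger V rho u = mu *: u ->
  wdot rho u u = 1 ->
  \sum_x u x * (- laplacian (extend0 u) (val x)) <= mu.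
Proof.
move=> V0 uE u1; rewrite -[leRHS]mulr1 -u1 -wdotZl -uE wdot_schrodinger.
apply: ler_sum => x _; rewrite mulrDl mulrC lerDl.
by rewrite -mulrA mulr_ge0 // -expr2 sqr_ge0.
Qed.

(** The pairing in direction a is bond a u / (2 n).  As the Dirichlet energy K is
mass u minus the mean of the bonds, the pairings add up to (mass u - K) / 2. *)
Lemma commutator_pairing_ge (u : {ffun Omega -> R^o}) mu rho_max :
  (0 < n)%N -> (forall x, 0 <= V x) -> (forall x, rho x <= rho_max) ->
  schrodinger V rho u = mu *: u -> wdot rho u u = 1 ->
  (rho_max^-1 - mu) / 2 <=
  \sum_a wdot rho (schrodinger V rho (coord_mul a u) - mu *: coord_mul a u)
                  (coord_mul a u).
Proof.
move=> n0 V0 rhoM uE u1.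
have nR : (n%:R : R) != 0 by rewrite pnatr_eq0 -lt0n.
have pairE a :
    wdot rho (schrodinger V rho (coord_mul a u) - mu *: coord_mul a u)
             (coord_mul a u) = (2 * n)%:R^-1 * bond a u.
  rewrite -sum_dir_diff_mul mulr_sumr; apply: eq_bigr => x _.
  rewrite commutatorE //; have r0 : rho x != 0 by rewrite gt_eqF.
  by field; rewrite r0 nR.
under eq_bigr do rewrite pairE.
have massM : rho_max^-1 <= mass u.
  have [x _|] := pickP (fun x : Omega => true); last first.
    move=> O0; move: u1; rewrite /wdot big1 => [/esym/eqP|x _].
      by rewrite oner_eq0.
    by have := O0 x.
  have M0 : 0 < rho_max by exact: lt_le_trans (rho_gt0 x) (rhoM x).
  rewrite -div1r ler_pdivrMr // mulrC -u1 /mass mulr_sumr.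
  by apply: ler_sum => y _; rewrite expr2 ler_wpM2r // -expr2 sqr_ge0.
have := energy_le_eigenvalue V0 uE u1.
rewrite dirichlet_energyE sumrB sumr_const card_ord -[mass u *+ n]mulr_natl.
rewrite -mulr_sumr natrM invfM mulrBr mulKf //; nra.
Qed.

(** By commutatorE the squared norm in direction a carries the weight 1 / rho, at
most 1 / rho_min, and the sum of the squared centred differences is at most
8 (mass u - bond a u); over all directions these add up to 8 n K. *)
Lemma commutator_norm_le (u : {ffun Omega -> R^o}) mu rho_min :
  (0 < n)%N -> (forall x, 0 <= V x) -> 0 < rho_min ->
  (forall x, rho_min <= rho x) ->
  schrodinger V rho u = mu *: u -> wdot rho u u = 1 ->
  \sum_a wdot rho (schrodinger V rho (coord_mul a u) - mu *: coord_mul a u)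
                  (schrodinger V rho (coord_mul a u) - mu *: coord_mul a u)
  <= 2 / (n%:R * rho_min) * mu.
Proof.
move=> n0 V0 m0 rhom uE u1.
have nR : 0 < (n%:R : R) by rewrite ltr0n.
pose c : R := (2 * n)%:R^-1 ^+ 2 / rho_min.
have c0 : 0 <= c by rewrite divr_ge0 ?sqr_ge0 // ltW.
have normE a :
    wdot rho (schrodinger V rho (coord_mul a u) - mu *: coord_mul a u)
             (schrodinger V rho (coord_mul a u) - mu *: coord_mul a u)
    <= c * (8 * (mass u - bond a u)).
  apply: le_trans (ler_wpM2l c0 (sum_dir_diff_sqr a u)).
  rewrite mulr_sumr; apply: ler_sum => x _; rewrite commutatorE //.
  have r0 := rho_gt0 x.
  rewrite [leLHS](_ : _ =
      (2 * n)%:R^-1 ^+ 2 * dir_diff a u x ^+ 2 * (rho x)^-1).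
    rewrite /c [leRHS]mulrAC; apply: ler_wpM2l.
      by rewrite -exprMn sqr_ge0.
    by rewrite lef_pV2 ?posrE.
  by field; rewrite !gt_eqF.
apply: (le_trans (ler_sum _ (fun a _ => normE a))).
have := energy_le_eigenvalue V0 uE u1.
rewrite dirichlet_energyE -!mulr_sumr.
set S := \sum_a _ => SK.
have -> : c * (8 * S) = 2 / (n%:R * rho_min) * (n%:R^-1 * S).
  by rewrite /c natrM; field; rewrite !gt_eqF.
by rewrite ler_wpM2l // divr_ge0 // mulr_ge0 // ltW.
Qed.

End Lattice.

(** * The eigenvalue inequality *)

Theorem theorem1p3 (R : realType) (n : nat) (hn : (1 <= n)%N)
    (Omega : {fset 'rV[int]_n}) (V rho : Omega -> R)
    (hV : forall x, 0 <= V x) (hrho : forall x, 0 < rho x)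
    (rho_min rho_max : R)
    (hmin : is_min rho rho_min) (hmax : is_max rho rho_max)
    (lambda : seq R) (hlambda : eigenvalue_seq V rho lambda)
    (k : nat) (hk : (1 <= k <= #|` Omega| - 1)%N) :
  (((n%:R * k%:R / 4 *
      (rho_min / rho_max - rho_min / k%:R * \sum_(i < k) lambda`_i))%:E
    : \bar R)
   <= gap_sum lambda k)%E.
Proof.
rewrite /gap_sum; case: ifPn => [_|/existsPn gap]; first by rewrite leey.
rewrite lee_fin.
case: hlambda => sizeN sortedl dimE; case/andP: hk => k0 kN.
have cardE : #|{: Omega}| = size lambda by rewrite sizeN cardfE.
have kT : (k < #|{: Omega}|)%N.
  rewrite cardE sizeN (leq_ltn_trans kN) // subn1 ltn_predL.
  exact: leq_trans k0 (leq_trans kN (leq_subr _ _)).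
have [e []] := orthonormal_eigenvectors hrho (schrodinger_symmetric V hrho)
  (fun mu => eq_leq (dimE mu)).
rewrite -cardE => oe eigE.
have le_nth i j : (i <= j < #|{: Omega}|)%N -> lambda`_i <= lambda`_j.
  rewrite cardE => /andP[ij jN].
  by apply: (sorted_leq_nth le_trans le_refl 0 sortedl) => //=;
    rewrite ?inE // (leq_ltn_trans ij).
have lt_k i : (i < k)%N -> lambda`_i < lambda`_k.
  move=> ik; rewrite lt_def (gap (Ordinal ik)) le_nth //.
  by rewrite (ltnW ik) kT.
have [[xm xmE] rhom] := hmin; have [_ rhoM] := hmax.
have m0 : 0 < rho_min by rewrite -xmE.
have M0 : 0 < rho_max by rewrite (lt_le_trans m0) // -xmE; apply: rhoM.
have nR : 0 < (n%:R : R) by rewrite ltr0n.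
have kR : 0 < (k%:R : R) by rewrite ltr0n.
have norm1 i : (i < k)%N -> wdot rho (e i) (e i) = 1.
  by move=> ik; rewrite oe ?eqxx ?(ltn_trans ik).
have eigk i : (i < k)%N -> schrodinger V rho (e i) = lambda`_i *: e i.
  by move=> ik; rewrite eigE ?(ltn_trans ik).
pose r a i := schrodinger V rho (coord_mul a (e i)) -
  lambda`_i *: coord_mul a (e i).
have HP : \sum_a \sum_(i < k) wdot rho (r a i) (coord_mul a (e i)) <=
    \sum_a \sum_(i < k) wdot rho (r a i) (r a i) / (lambda`_k - lambda`_i).
  apply: ler_sum => a _.
  have := commutator_gap_le (schrodinger_symmetric V hrho)
    (coord_mul_symmetric rho a) oe eigE kT lt_k.
  rewrite !big_mkord; apply => j /andP[kj jT]; apply: le_nth.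
  by rewrite kj.
rewrite exchange_big [leRHS]exchange_big /= in HP.
have lower : \sum_(i < k) (rho_max^-1 - lambda`_i) / 2 <=
    \sum_(i < k) 2 / (n%:R * rho_min) * (lambda`_i / (lambda`_k - lambda`_i)).
  apply: (le_trans _ (le_trans HP _)); apply: ler_sum => i _.
    have := commutator_pairing_ge hrho hn hV rhoM (eigk _ (ltn_ord i))
      (norm1 _ (ltn_ord i)); exact.
  rewrite -mulr_suml mulrA ler_wpM2r //.
    by rewrite invr_ge0 subr_ge0 ltW // lt_k.
  have := commutator_norm_le hrho hn hV m0 rhom (eigk _ (ltn_ord i))
    (norm1 _ (ltn_ord i)); exact.
move: lower; rewrite -mulr_suml -mulr_sumr sumrB sumr_const card_ord.
rewrite -[_ *+ k]mulr_natl.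
set A := \sum_(i < k) _; set B := \sum_(i < k) _ => AB.
rewrite [leLHS](_ : _ =
    (n%:R * rho_min / 2) * ((k%:R * rho_max^-1 - A) / 2)); last first.
  by field; rewrite !gt_eqF.
rewrite [leRHS](_ : _ = (n%:R * rho_min / 2) * (2 / (n%:R * rho_min) * B)).
  by rewrite ler_wpM2l // divr_ge0 // mulr_ge0 // ltW.
by field; rewrite !gt_eqF.
Qed.
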